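(* Let $X_1,\dots,X_n$ be compact Hausdorff spaces, $X=X_1\times\cdots\times X_n$, and let $M=\{\sum_{i=1}^ng_i(x_i):g_i\in C(X_i),\ i=1,\dots,n\}\subset C(X)$. For every $f\in C(X)$, the error of approximation $E(f)=\inf_{g\in M}\|f-g\|_{C(X)}$ satisfies $$E(f)=\sup_{l\subset X}\left|\int_Xf\,d\mu_l\right|,$$ where the supremum is taken over all minimal projection cycles $l$ of $X$.
   Context: $C(\cdot)$ denotes real continuous functions with the uniform norm. Let $\pi_i:X\to X_i$ be the coordinate projections and, for a point $a\in X_i$, let $\chi_a$ be the characteristic function of the one-point set $\{a\}$ on $X_i$. A finite set of distinct points $p=\{x_1,\dots,x_m\}\subset X$ is a projection cycle if there is a vector $\lambda=(\lambda_1,\dots,\lambda_m)$ with all coordinates nonzero real numbers such that $\sum_{j=1}^m\lambda_j\chi_{\pi_i(x_j)}=0$ for $i=1,\dots,n$. A projection cycle is minimal if it contains no projection cycle as a proper subset. For a minimal projection cycle $l=\{x_1,\dots,x_m\}$ the vector $\lambda$ is unique up to multiplication by a constant; normalizing by $\sum_{j=1}^m|\lambda_j|=1$ one gets, uniquely up to sign, the measure $\mu_l=\sum_{j=1}^m\lambda_j\delta_{x_j}$, where $\delta_x$ is the unit point mass at $x$. The supremum over an empty family is understood to be $0$. *)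

(* Defs.v *)
From HB Require Import structures.
From mathcomp Require Import all_boot all_order all_algebra finmap.
From mathcomp Require Import all_classical all_reals all_analysis.

Set Implicit Arguments.
Unset Strict Implicit.
Unset Printing Implicit Defensive.

Import Order.TTheory GRing.Theory Num.Theory.
Import numFieldNormedType.Exports.

Local Open Scope classical_set_scope.
Local Open Scope ring_scope.

(* [sup set0 = 0], so the norm is 0 when [X] is empty. *)
Definition uniform_norm (R : realType) (X : Type) (h : X -> R) : R :=
  sup (range (fun x => `|h x|)).

Definition univariate_sums (R : realType) (n : nat)
    (X : 'I_n -> topologicalType) : set (prod_topology X -> R) :=
  [set g | exists G : forall i, X i -> R,
     (forall i, continuous (G i)) /\ g = (fun x => \sum_(i < n) G i (x i))].

Definition approx_error (R : realType) (n : nat) (X : 'I_n -> topologicalType)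
    (f : prod_topology X -> R) : R :=
  inf [set uniform_norm (f \- g) | g in @univariate_sums R n X].

(* [lam] matters only through its values on [p]. *)
Definition cycle_vector (R : realType) (n : nat) (X : 'I_n -> topologicalType)
    (p : {fset prod_topology X}) (lam : prod_topology X -> R) : Prop :=
  (forall x, x \in p -> lam x != 0) /\
  (forall (i : 'I_n) (t : X i), \sum_(x <- p) lam x * \1_[set x i] t = 0).

(* A cycle has at least one point: the empty set satisfies the equations
   vacuously and would leave no minimal cycle at all. *)
Definition projection_cycle (R : realType) (n : nat)
    (X : 'I_n -> topologicalType) (p : {fset prod_topology X}) : Prop :=
  p != fset0 /\ exists lam : prod_topology X -> R, cycle_vector p lam.

Definition minimal_projection_cycle (R : realType) (n : nat)
    (X : 'I_n -> topologicalType) (l : {fset prod_topology X}) : Prop :=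
  projection_cycle R l /\
  forall p : {fset prod_topology X}, (p `<` l)%fset -> ~ projection_cycle R p.

Definition normalized_cycle_vector (R : realType) (n : nat)
    (X : 'I_n -> topologicalType) (l : {fset prod_topology X})
    (lam : prod_topology X -> R) : Prop :=
  cycle_vector l lam /\ \sum_(x <- l) `|lam x| = 1.

(* Measurable types are required to be pointed, topological spaces are not.
   [borel x0] is the Borel sigma-algebra of [T] with [x0] as designated point;
   its measurable sets do not depend on [x0]. *)
Definition pointed_at (T : topologicalType) (x0 : T) : Type := T.

HB.instance Definition _ (T : topologicalType) (x0 : T) :=
  Topological.on (pointed_at x0).
HB.instance Definition _ (T : topologicalType) (x0 : T) :=
  isPointed.Build (pointed_at x0) x0.

Definition borel (T : topologicalType) (x0 : T)
    : measurableType (sigma_display (@open (pointed_at x0))) :=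
  g_sigma_algebraType (@open (pointed_at x0)).

Definition charge_add d (T : measurableType d) (R : realType)
  (mu nu : {charge set T -> \bar R}) : {charge set T -> \bar R} := cadd mu nu.

(* The signed measure giving mass [lam x] to each point [x] of [l]. *)
Definition point_masses d (T : measurableType d) (R : realType)
    (l : seq T) (lam : T -> R) : {charge set T -> \bar R} :=
  \big[@charge_add d T R/(czero : {charge set T -> \bar R})]_(x <- l)
    (cscale (lam x) (charge_of_finite_measure (dirac x))
       : {charge set T -> \bar R}).

(* Integral against a signed measure, as the difference of the integrals
   against its positive and negative variations. *)
Definition charge_integral d (T : measurableType d) (R : realType)
    (mu : {charge set T -> \bar R}) (f : T -> R) : R :=
  let: exist P exN := cid (Hahn_decomposition mu) in
  let: exist N muPN := cid exN in
  Rintegral (jordan_pos muPN) setT f - Rintegral (jordan_neg muPN) setT f.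

Definition cycle_measure (R : realType) (n : nat) (X : 'I_n -> topologicalType)
    (l : {fset prod_topology X}) (lam : prod_topology X -> R)
    (x0 : prod_topology X) : {charge set (borel x0) -> \bar R} :=
  @point_masses _ (borel x0) R l lam.

(* The normalized vector of a minimal cycle is unique up to sign, so both
   choices give the same absolute value. *)
Definition cycle_integrals (R : realType) (n : nat)
    (X : 'I_n -> topologicalType) (f : prod_topology X -> R) : set R :=
  [set r | exists (l : {fset prod_topology X}) (lam : prod_topology X -> R)
      (x0 : prod_topology X),
    [/\ minimal_projection_cycle R l, normalized_cycle_vector l lam
      & r = `|charge_integral (cycle_measure l lam x0) f|]].

(* Main.v *)
(** By weak duality each [|\int f dmu_l|] is at most [E f].  For the converse,
    let [s] bound all these integrals.  On a finite grid, Farkas' lemma yields a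
    sum of univariate functions within [s] of [f], because every signed measure
    on the grid with zero marginals splits, without cancellation, into measures
    carried by minimal projection cycles.  To pass to [X], equip each [X i] with
    the pseudometric [sup_z |f z[i:=s] - f z[i:=t]|], which is continuous by
    compactness, take finite [e]-nets in it, and extend the univariate functions
    from the grid of the nets by averaging with the weights
    [max(e - dist, 0)].  Each average is bounded above and below by values at
    net points within [e], so the error grows by at most [n * e]. *)

Require Import Defs.
From mathcomp Require Import all_boot all_order all_algebra finmap.
From mathcomp Require Import ring lra.
From mathcomp Require Import all_classical all_reals all_analysis.
From mathcomp Require Import measurable_realfun.

Set Implicit Arguments.
Unset Strict Implicit.
Unset Printing Implicit Defensive.

Import Order.TTheory GRing.Theory Num.Theory.
Import numFieldNormedType.Exports.

Local Open Scope classical_set_scope.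
Local Open Scope ring_scope.

(** * Linear inequalities and finite-dimensional duality *)

(** The largest lower bound works or, when there is none, the smallest upper bound. In [farkas] this
    chooses the value of the eliminated unknown. *)
Lemma exists_between (R : realFieldType) (I J : finType)
    (P : pred I) (Q : pred J) (lo : I -> R) (up : J -> R) :
    (forall i j, P i -> Q j -> lo i <= up j) ->
  exists t, (forall i, P i -> lo i <= t) /\ (forall j, Q j -> t <= up j).
Proof.
move=> le_lo_up; case: (pickP P) => [i0 Pi0|P0].
  exists (lo [arg max_(i > i0 | P i) lo i]%O).
  case: arg_maxP => // i Pi lo_max; split=> [k /lo_max //|j Qj].
  exact: le_lo_up.
case: (pickP Q) => [j0 Qj0|Q0].
  exists (up [arg min_(j < j0 | Q j) up j]%O).
  by case: arg_minP => // j Qj up_min; split=> [k|k /up_min//]; rewrite P0.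
by exists 0; split=> k; rewrite ?P0 ?Q0.
Qed.

(** Induction on the unknowns [s]: eliminating one leaves a system whose rows are nonnegative
    combinations of the old rows, so the dual condition passes to it; its solution then leaves an
    interval of values for the eliminated unknown. *)
Lemma farkas (R : realFieldType) (J : eqType) (s : seq J) (I : finType)
    (a : I -> J -> R) (b : I -> R) :
    uniq s ->
    (forall y : I -> R, (forall i, 0 <= y i) ->
       (forall j, j \in s -> \sum_i y i * a i j = 0) ->
       0 <= \sum_i y i * b i) ->
  exists c : J -> R, forall i, \sum_(j <- s) a i j * c j <= b i.
Proof.
elim: s I a b => [|j0 s IHs] I a b /=.
  move=> _ dual; exists (fun=> 0) => i; rewrite big_nil.
  (* Without unknowns every multiplier is admissible; the [i]-th unit vector yields [0 <= b i]. *)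
  have := dual (fun k => (k == i)%:R).
  rewrite (bigD1 i) //= eqxx mul1r big1 ?addr0; last first.
    by move=> k /negPf->; rewrite mul0r.
  by apply=> // k; rewrite ler0n.
move=> /andP[j0Ns us] dual.
pose K : finType := (I + I * I)%type.
(* Fourier-Motzkin: nonnegative combinations of the rows killing column j0 *)
pose C (k : K) (i : I) : R :=
  match k with
  | inl i' => if a i' j0 == 0 then (i == i')%:R else 0
  | inr (p, q) => if (0 < a p j0) && (a q j0 < 0)
      then a p j0 * (i == q)%:R - a q j0 * (i == p)%:R else 0
  end.
have C_ge0 k i : 0 <= C k i.
  case: k => [i'|[p q]] /=; first by case: ifP => // _; exact: ler0n.
  case: ifP => // /andP[ap aq].
  by rewrite -mulNr addr_ge0 // mulr_ge0 ?ler0n// ?oppr_ge0 ltW.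
have sumC k (F : I -> R) : \sum_i C k i * F i =
    match k with
    | inl i' => if a i' j0 == 0 then F i' else 0
    | inr (p, q) => if (0 < a p j0) && (a q j0 < 0)
        then a p j0 * F q - a q j0 * F p else 0
    end.
  have sum1 i' : \sum_i (i == i')%:R * F i = F i'.
    rewrite (bigD1 i') //= eqxx mul1r big1 ?addr0 // => i /negPf->.
    by rewrite mul0r.
  case: k => [i'|[p q]] /=; case: ifP => _; rewrite ?sum1 //;
    try by rewrite big1 // => i _; rewrite mul0r.
  rewrite -!sum1 !mulr_sumr -sumrB; apply: eq_bigr => i _.
  by rewrite mulrBl !mulrA.
pose a' k j := \sum_i C k i * a i j.
pose b' k := \sum_i C k i * b i.
have C_j0 k : a' k j0 = 0.
  rewrite /a' sumC; case: k => [i'|[p q]]; case: ifP => //; first by move/eqP.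
  by rewrite [X in _ - X]mulrC subrr.
have swap (y : K -> R) (F : I -> R) :
    \sum_i (\sum_k y k * C k i) * F i = \sum_k y k * \sum_i C k i * F i.
  under eq_bigr do rewrite mulr_suml.
  rewrite exchange_big; apply: eq_bigr => k _; rewrite mulr_sumr.
  by apply: eq_bigr => i _; rewrite mulrA.
have [c cP] : exists c : J -> R, forall k, \sum_(j <- s) a' k j * c j <= b' k.
  apply: IHs => // y y_ge0 ya'.
  (* Multipliers of the eliminated system, composed with [C], are multipliers of the original one,
     and they annihilate column [j0] as well. *)
  rewrite /b' -swap; apply: dual => [i|j].
    by apply: sumr_ge0 => k _; rewrite mulr_ge0.
  rewrite swap inE => /predU1P[->|/ya' //].
  by rewrite big1 // => k _; have := C_j0 k; rewrite /a' => ->; rewrite mulr0.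
pose r i := b i - \sum_(j <- s) a i j * c j.
have rP k : 0 <= \sum_i C k i * r i.
  have := cP k; rewrite -subr_ge0; congr (_ <= _).
  under [RHS]eq_bigr do rewrite mulrBr.
  rewrite sumrB; congr (_ - _).
  under eq_bigr do rewrite mulr_suml.
  rewrite exchange_big; apply: eq_bigr => i _; rewrite mulr_sumr.
  by apply: eq_bigr => j _; rewrite mulrA.
(* Rows with a negative coefficient at [j0] bound the unknown from below, those with a positive one
   from above; the combined row [inr (p, q)] says that these bounds are compatible. *)
have [t [tlo tup]] : exists t, (forall i, a i j0 < 0 -> r i / a i j0 <= t) /\
    (forall i, 0 < a i j0 -> t <= r i / a i j0).
  apply: exists_between => q p aq ap.
  have := rP (inr (p, q)); rewrite sumC ap aq /= subr_ge0 => h.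
  by rewrite ler_ndivrMr// mulrAC ler_pdivrMr// mulrC [leRHS]mulrC.
exists (fun j => if j == j0 then t else c j) => i.
rewrite big_cons eqxx.
have -> : \sum_(j <- s) a i j * (if j == j0 then t else c j) =
    \sum_(j <- s) a i j * c j.
  apply: eq_big_seq => j js; case: eqP => // jj0.
  by rewrite -jj0 js in j0Ns.
rewrite -lerBrDr -/(r i).
case: (ltgtP (a i j0) 0) => [ai|ai|ai].
- by rewrite mulrC -ler_ndivrMr ?tlo.
- by rewrite mulrC -ler_pdivlMr ?tup.
- by have := rP (inl i); rewrite sumC ai eqxx mul0r.
Qed.

(** Each absolute value is two linear inequalities, indexed by [T + T]. Multipliers [y] of the pair
    produce [lam x = y (inr x) - y (inl x)], whose absolute value is at most the sum of the two. *)
Lemma best_approximation_duality (R : realFieldType) (J T : finType)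
    (h : J -> T -> R) (f : T -> R) (s : R) :
    0 <= s ->
    (forall lam : T -> R, (forall j, \sum_x lam x * h j x = 0) ->
       \sum_x lam x * f x <= s * \sum_x `|lam x|) ->
  exists c : J -> R, forall x, `|f x - \sum_j c j * h j x| <= s.
Proof.
move=> s_ge0 dual.
pose a (i : T + T) j := match i with inl x => h j x | inr x => - h j x end.
pose b (i : T + T) := match i with inl x => s + f x | inr x => s - f x end.
have [||c cP] := @farkas R J (enum J) (T + T)%type a b.
- exact: enum_uniq.
- move=> y y_ge0 ya.
  have := dual (fun x => y (inr x) - y (inl x)).
  have -> : \sum_i y i * b i = s * (\sum_x (y (inl x) + y (inr x))) -
      \sum_x (y (inr x) - y (inl x)) * f x.
    rewrite big_sumType mulr_sumr /= -big_split -sumrB /=.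
    by apply: eq_bigr => x _; ring.
  move=> h1; rewrite subr_ge0; apply: (le_trans (h1 _)) => [j|].
    have := ya j; rewrite mem_enum big_sumType /= => /(_ isT).
    rewrite -big_split /= => /(congr1 -%R); rewrite oppr0 -sumrN => h0.
    by apply: etrans h0; apply: eq_bigr => x _; ring.
  rewrite ler_wpM2l //; apply: ler_sum => x _.
  by rewrite (le_trans (ler_normB _ _)) // !ger0_norm // addrC.
exists c => x; rewrite ler_norml.
have := cP (inl x); have := cP (inr x).
rewrite !big_enum /=.
have -> : \sum_j - h j x * c j = - \sum_j c j * h j x.
  by rewrite -sumrN; apply: eq_bigr => j _; ring.
have -> : \sum_j h j x * c j = \sum_j c j * h j x.
  by apply: eq_bigr => j _; ring.
by move=> h1 h2; lra.
Qed.

(** * Measures with zero marginals and minimal cycles *)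

Section cycles.
Variables (R : realType) (n : nat) (X : 'I_n -> topologicalType).
Local Notation XX := (prod_topology X).
Implicit Types (l p : {fset XX}) (lam nu : XX -> R).

(** Zero marginals alone, with zero coefficients allowed: unlike [cycle_vector], this condition is
    stable under linear combinations. *)
Let balanced l lam :=
  forall (i : 'I_n) (t : X i), \sum_(x <- l) lam x * \1_[set x i] t = 0.

Lemma indic_point i (x : XX) (t : X i) : \1_[set x i] t = (t == x i)%:R :> R.
Proof.
by rewrite indicE; congr (nat_of_bool _)%:R; apply/idP/eqP; rewrite inE.
Qed.

(** For each [i], group the points by their [i]-th coordinate [t]: [g i] is constant on such a
    group, and the total mass of the group is zero. *)
Lemma cycle_vector_integral_sums l lam (g : forall i, X i -> R) :
  cycle_vector l lam -> \sum_(x <- l) lam x * \sum_(i < n) g i (x i) = 0.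
Proof.
move=> [_ lamE].
under eq_bigr do rewrite mulr_sumr.
rewrite exchange_big big1 //= => i _.
have -> : \sum_(x <- l) lam x * g i (x i) =
    \sum_(x <- l) \sum_(t <- undup [seq (x : XX) i | x <- l])
      g i t * (lam x * \1_[set x i] t).
  apply: eq_big_seq => x xl.
  rewrite (bigD1_seq (x i)) ?undup_uniq //=; last first.
    by rewrite mem_undup map_f.
  rewrite indic_point eqxx mulr1 mulrC big1 ?addr0 // => t /negPf tx.
  by rewrite indic_point tx !mulr0.
rewrite exchange_big big1 //= => t _.
by rewrite -mulr_sumr lamE mulr0.
Qed.

(** Strong induction on the size of the support. A minimal support is a single cycle, and
    normalizing reduces to the hypothesis. Otherwise [lam] splits into two vectors of smaller
    support whose total variations add up without loss. *)
Lemma integral_le_of_minimal_cycles (f : XX -> R) (s : R) :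
    (forall l lam, minimal_projection_cycle R l ->
       normalized_cycle_vector l lam -> `|\sum_(x <- l) lam x * f x| <= s) ->
  forall l lam, balanced l lam ->
    \sum_(x <- l) lam x * f x <= s * \sum_(x <- l) `|lam x|.
Proof.
move=> min_le l0 lam0; pose supp l lam := [fset x in l | lam x != 0]%fset.
have [m] := ubnP #|` supp l0 lam0|; elim: m l0 lam0 => // m IHm l0 lam.
rewrite ltnS; set l := supp l0 lam => lm bal0.
have l_sub : (l `<=` l0)%fset by apply: fset_sub.
have l_out x : x \in l0 -> x \notin l -> lam x = 0.
  by rewrite !inE /= => -> /= /negPn/eqP.
have bal : balanced l lam.
  move=> i t; rewrite -[RHS](bal0 i t); apply: (big_fset_incl _ l_sub).
  by move=> x xl0 xNl; rewrite l_out // mul0r.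
rewrite -(big_fset_incl _ l_sub); last first.
  by move=> x xl0 xNl; rewrite l_out ?mul0r.
rewrite -(big_fset_incl _ l_sub (F := fun x => `|lam x|)); last first.
  by move=> x xl0 xNl; rewrite l_out ?normr0.
have lam_neq0 x : x \in l -> lam x != 0 by rewrite !inE => /andP[].
have cl : cycle_vector l lam by [].
have [l0_|l_neq0] := eqVneq l fset0; first by rewrite l0_ !big_seq_fset0 mulr0.
have N_gt0 : 0 < \sum_(x <- l) `|lam x|.
  case/fset0Pn: l_neq0 => y yl.
  rewrite (big_fsetD1 y) //= ltr_pwDl ?normr_gt0 ?lam_neq0 //.
  exact: sumr_ge0.
have lproj : projection_cycle R l by split=> //; exists lam.
have [lmin|] := pselect (minimal_projection_cycle R l).
  set N := \sum_(x <- l) `|lam x| in N_gt0 *.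
  have := min_le l (fun x => lam x / N) lmin.
  have -> : \sum_(x <- l) lam x / N * f x = (\sum_(x <- l) lam x * f x) / N.
    by rewrite mulr_suml; apply: eq_bigr => x _; rewrite mulrAC.
  move=> h; rewrite -ler_pdivrMr //.
  apply: le_trans (h _); first exact: ler_norm.
  split; first split=> [x xl|i t].
  - by rewrite mulf_neq0 ?lam_neq0 // invr_eq0 gt_eqF.
  - transitivity (N^-1 * \sum_(x <- l) lam x * \1_[set x i] t).
      by rewrite mulr_sumr; apply: eq_bigr => x _; rewrite mulrAC mulrC.
    by rewrite bal mulr0.
  - under eq_bigr do rewrite normrM normfV (gtr0_norm N_gt0).
    by rewrite -mulr_suml mulfV // gt_eqF.
move=> /not_andP[//|] /existsNP[p] /not_implyP[pl] /contrapT.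
move=> [/fset0Pn[y yp] [nu [nu_neq0 nuE]]].
(* With r = nu/lam on p and 0 elsewhere, lam splits, up to the positive factor
   max r - min r, into (max r - r) lam and (r - min r) lam; these have the
   signs of lam and smaller supports. *)
pose r x := if x \in p then nu x / lam x else 0.
have psub : (p `<=` l)%fset by case/andP: pl.
have rlam x : x \in l -> lam x * r x = if x \in p then nu x else 0.
  by move=> xl; rewrite /r; case: ifP; rewrite ?mulr0 // mulrC mulfVK ?lam_neq0.
have balr : balanced l (fun x => lam x * r x).
  move=> i t; rewrite -[RHS](nuE i t).
  rewrite -(big_fset_incl _ psub); last first.
    by move=> x xl xNp; rewrite rlam // (negPf xNp) mul0r.
  by apply: eq_big_seq => x xp; rewrite rlam ?xp // (fsubsetP psub).
have [z zl zNp] : exists2 z, z \in l & z \notin p.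
  by case/andP: pl => _ /fsubsetPn.
have yl : y \in l by apply: (fsubsetP psub).
(* A nonnegative weight preserves the signs of [lam], and its zero in [l] removes a point from the
   support, so the induction hypothesis applies. *)
have IHw (w : XX -> R) : (forall x, x \in l -> 0 <= w x) ->
    (exists2 x, x \in l & w x = 0) -> balanced l (fun x => lam x * w x) ->
    \sum_(x <- l) lam x * w x * f x <= s * \sum_(x <- l) `|lam x| * w x.
  move=> w_ge0 [x0 x0l wx0] balw.
  have -> : \sum_(x <- l) `|lam x| * w x = \sum_(x <- l) `|lam x * w x|.
    by apply: eq_big_seq => x xl; rewrite normrM (ger0_norm (w_ge0 _ xl)).
  apply: IHm => //; apply: leq_trans lm; apply: fproper_ltn_card.
  rewrite fproperE fset_sub /=; apply/fsubsetPn.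
  by exists x0 => //; rewrite !inE /= wx0 mulr0 eqxx andbF.
have [[a al amax] [b bl bmin]] :
    (exists2 a, a \in l & forall x, x \in l -> r x <= r a) /\
    (exists2 b, b \in l & forall x, x \in l -> r b <= r x).
  split.
    exists (val [arg max_(i > [` yl]%fset) r (val i)]%O); first exact: valP.
    case: arg_maxP => // i _ imax x xl; exact: (imax [` xl]%fset).
  exists (val [arg min_(i < [` yl]%fset) r (val i)]%O); first exact: valP.
  case: arg_minP => // i _ imin x xl; exact: (imin [` xl]%fset).
(* [r] is not constant on [l]: it vanishes at [z], outside [p], but not at [y], in [p]. *)
have ab : 0 < r a - r b.
  have rz : r z = 0 by rewrite /r (negPf zNp).
  have ry : r y != 0.
    by rewrite /r yp mulf_neq0 ?nu_neq0 // invr_eq0 lam_neq0.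
  rewrite subr_gt0 lt_neqAle bmin // andbT; apply: contra ry => /eqP rba.
  have := amax z zl; have := bmin z zl; have := amax y yl; have := bmin y yl.
  by rewrite -rba rz => *; apply/eqP; lra.
have h1 := IHw (fun x => r a - r x).
have h2 := IHw (fun x => r x - r b).
have balB (w1 w2 : XX -> R) (c d : R) : balanced l w1 -> balanced l w2 ->
    balanced l (fun x => c * w1 x + d * w2 x).
  move=> b1 b2 i t; transitivity (c * (\sum_(x <- l) w1 x * \1_[set x i] t) +
      d * (\sum_(x <- l) w2 x * \1_[set x i] t)).
    rewrite !mulr_sumr -big_split /=.
    by apply: eq_bigr => x _; ring.
  by rewrite b1 b2 !mulr0 addr0.
rewrite -(ler_pM2l ab) mulrCA.
apply: (@le_trans _ _ (\sum_(x <- l) lam x * (r a - r x) * f x +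
                       \sum_(x <- l) lam x * (r x - r b) * f x)).
  rewrite mulr_sumr -big_split le_eqVlt; apply/orP; left; apply/eqP.
  by apply: eq_bigr => x _ /=; ring.
rewrite [leRHS](_ : _ = s * (\sum_(x <- l) `|lam x| * (r a - r x)) +
                       s * (\sum_(x <- l) `|lam x| * (r x - r b))); last first.
  rewrite -mulrDr; congr (_ * _); rewrite mulr_sumr -big_split /=.
  by apply: eq_bigr => x _ /=; ring.
apply: lerD; [apply: h1 => [x xl||]|apply: h2 => [x xl||]].
- by rewrite subr_ge0 amax.
- by exists a => //; rewrite subrr.
- have -> : (fun x => lam x * (r a - r x)) =
      (fun x => r a * lam x + -1 * (lam x * r x)) by apply/funext => x; ring.
  exact: balB.
- by rewrite subr_ge0 bmin.
- by exists b => //; rewrite subrr.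
- have -> : (fun x => lam x * (r x - r b)) =
      (fun x => (- r b) * lam x + 1 * (lam x * r x)) by apply/funext => x; ring.
  exact: balB.
Qed.

(** Duality on the finite set [P], with the indicators of the coordinate values occurring in [P] as
    spanning functions: orthogonality to all of them means zero marginals. *)
Lemma finite_approximation (f : XX -> R) (s : R) (P : {fset XX}) :
    0 <= s ->
    (forall l lam, minimal_projection_cycle R l ->
       normalized_cycle_vector l lam -> `|\sum_(x <- l) lam x * f x| <= s) ->
  exists g : forall i, X i -> R,
    forall x, x \in P -> `|f x - \sum_(i < n) g i (x i)| <= s.
Proof.
move=> s_ge0 min_le.
pose h (j : 'I_n * P) (x : P) : R := (fsval x j.1 == fsval j.2 j.1)%:R.
have [|c cP] :=
  @best_approximation_duality R _ _ h (fun x => f (fsval x)) s s_ge0.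
  move=> lam lam_h.
  pose lam' x := oapp lam 0 (insub x : option P).
  have lam'E (x : P) : lam' (fsval x) = lam x by rewrite /lam' (valK x).
  have <- : \sum_(x <- P) lam' x * f x = \sum_x lam x * f (fsval x).
    by rewrite big_seq_fsetE; apply: eq_bigr => x _; rewrite lam'E.
  have <- : \sum_(x <- P) `|lam' x| = \sum_x `|lam x|.
    by rewrite big_seq_fsetE; apply: eq_bigr => x _; rewrite lam'E.
  apply: (integral_le_of_minimal_cycles min_le) => i t.
  rewrite big_seq_fsetE /=.
  under eq_bigr do rewrite lam'E indic_point.
  (* A value [t] that is the [i]-th coordinate of no point of [P] leaves only zero terms. *)
  have [[y ty]|tN] := pselect (exists y : P, t = fsval y i).
    rewrite -[RHS](lam_h (i, y)); apply: eq_bigr => x _.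
    by rewrite /h /= ty eq_sym.
  rewrite big1 // => x _; case: eqP => [tx|_]; last by rewrite mulr0.
  by case: tN; exists x.
exists (fun i t => \sum_(y : P) c (i, y) * (t == fsval y i)%:R) => x xP.
have := cP [` xP]%fset.
congr (`|_ - _| <= _); rewrite pair_bigA /=.
by apply: eq_bigr => -[i y] _.
Qed.

End cycles.

(** * Integration against finitely supported charges *)

Section finitely_supported_charges.
Context d (T : measurableType d) (R : realType).
Implicit Types (l : seq T) (lam f : T -> R).

Lemma Rintegral_finite_support (m : {finite_measure set T -> \bar R}) l f :
    (forall x : T, measurable [set x]) -> uniq l -> m (~` [set` l]) = 0%E ->
    measurable_fun setT f ->
  Rintegral m setT f = \sum_(x <- l) f x * fine (m [set x]).
Proof.
move=> m1 ul ml0 mf.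
have lE : [set` l] = \big[setU/set0]_(x <- l) [set x].
  by rewrite -bigcup_seq bigcup_imset1 image_id.
have ml : measurable [set` l].
  by apply: countable_measurable => //; exact/finite_set_countable/finite_seq.
have mfE : measurable_fun setT (EFin \o f) by exact/measurable_EFinP.
rewrite /Rintegral -(setUv [set` l]) integral_setU //; first last.
- by rewrite disj_set2E setICr.
- by rewrite setUv.
- exact: measurableC.
have -> : (\int[m]_(x in ~` [set` l]) (f x)%:E = 0)%E.
  apply: null_set_integral => //; first exact: measurableC.
  exact: measurable_funS mfE.
rewrite adde0 lE integral_bigsetU_EFin //; first last.
- exact: measurable_funS mfE.
- by move=> x y _ _ [z [-> ->]].
have fx x : (\int[m]_(y in [set x]) (f y)%:E)%E = (f x * fine (m [set x]))%:E.
  rewrite (eq_integral (cst (f x)%:E)); last by move=> y; rewrite inE => ->.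
  by rewrite integral_cst // EFinM fineK // fin_num_measure.
by under eq_bigr do rewrite fx; rewrite sumEFin.
Qed.

Lemma point_massesE l lam (A : set T) :
  point_masses l lam A = (\sum_(x <- l) lam x * \1_A x)%:E.
Proof.
rewrite /point_masses; elim: l => [|x l IHl]; first by rewrite !big_nil.
by rewrite !big_cons EFinD -IHl EFinM /charge_add /cadd /=.
Qed.

(** The Hahn decomposition is an arbitrary choice, but both Jordan parts are restrictions of the
    charge up to sign, hence vanish off [l]. Both integrals are thus finite sums, which the Jordan
    decomposition recombines point by point. *)
Lemma charge_integral_point_masses l lam f :
    (forall x : T, measurable [set x]) -> uniq l -> measurable_fun setT f ->
  charge_integral (point_masses l lam) f = \sum_(x <- l) lam x * f x.
Proof.
move=> m1 ul mf; rewrite /charge_integral.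
case: cid => P exN; case: cid => N muPN.
have ml : measurable (~` [set` l]).
  apply: measurableC; apply: countable_measurable => //.
  exact/finite_set_countable/finite_seq.
have off A : point_masses l lam (~` [set` l] `&` A) = 0%E.
  rewrite point_massesE big1_seq // => x /andP[_ xl].
  by rewrite indicE memNset ?mulr0 // => -[/(_ xl)].
have pos0 : jordan_pos muPN (~` [set` l]) = 0%E.
  by rewrite jordan_posE cjordan_posE /crestr0 mem_set //= /crestr off.
have neg0 : jordan_neg muPN (~` [set` l]) = 0%E.
  by rewrite jordan_negE cjordan_negE /crestr0 mem_set //= /crestr off oppe0.
rewrite !(@Rintegral_finite_support _ l) //.
rewrite -sumrB; apply: eq_big_seq => x xl; rewrite -mulrBr mulrC; congr (_ * _).
have := jordan_decomp muPN (m1 x).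
rewrite point_massesE /cadd /= cscaleN1 (bigD1_seq x) //= indicE mem_set //.
rewrite mulr1 big1 ?addr0; last first.
  by move=> y yx; rewrite indicE memNset ?mulr0 //; exact/eqP.
move=> /(congr1 fine) /= ->; rewrite fineD ?fin_num_measure //.
  by rewrite fineN.
by rewrite fin_numN fin_num_measure.
Qed.

End finitely_supported_charges.

(** * Continuity on products and on compact spaces *)

Lemma cvg_coordinates (I : eqType) (X : I -> topologicalType)
    (F : set_system (prod_topology X)) (x : prod_topology X) : Filter F ->
  (forall i, (fun y : prod_topology X => y i) @ F --> x i) -> F --> x.
Proof.
move=> FF Fx; apply/cvg_sup => i U.
rewrite nbhsE /= => -[B [[A oA <-] Ax] BU].
apply: filterS BU _; exact: (Fx i A (open_nbhs_nbhs (conj oA Ax))).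
Qed.

(** Convergence is checked coordinatewise: coordinate [i] is the second projection, every other one
    depends on the base point only. Joint continuity is what the tube argument for [oscillation]
    requires. *)
Lemma dfwith_continuous2 (I : eqType) (X : I -> topologicalType) (i : I)
    (z : prod_topology X) (t : X i) :
  (fun p : prod_topology X * X i => dfwith p.1 i p.2 : prod_topology X)
    @ filter_prod (nbhs z) (nbhs t) --> (dfwith z i t : prod_topology X).
Proof.
apply: cvg_coordinates => j.
case: (dfwithP z t j) => [|{}j ij].
  move=> U tU; have : nbhs (z, t) (snd @^-1` U) by exact: cvg_snd.
  move=> h; apply: (@filterS _ (nbhs (z, t)) _ _ _ _ h) => p /=.
  by rewrite dfwithin.
move=> U zU; have : nbhs (z, t) ((fun p => p.1 j) @^-1` U).
  exact: (@cvg_fst _ _ (nbhs z) (nbhs t) _ _ (@proj_continuous I X j z U zU)).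
move=> h; apply: (@filterS _ (nbhs (z, t)) _ _ _ _ h) => p /=.
by rewrite dfwithout.
Qed.


Section continuous_on_compact.
Variables (R : realType) (T : topologicalType).
Hypothesis Tcompact : compact [set: T].

Lemma continuous_compact_norm_bounded (h : T -> R) :
  continuous h -> exists B, forall x, `|h x| <= B.
Proof.
move=> hc; have : compact (h @` setT).
  by apply: continuous_compact => //; exact: continuous_subspaceT.
move=> /compact_bounded[M [_ Mh]]; exists (M + 1) => x.
by apply: (Mh (M + 1)); [rewrite ltrDl|exists x].
Qed.

Lemma uniform_norm_ge (h : T -> R) x :
  continuous h -> `|h x| <= uniform_norm h.
Proof.
move=> hc; apply: ub_le_sup; last by exists x.
have [B hB] := continuous_compact_norm_bounded hc.
by exists B => _ [y _ <-].
Qed.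

End continuous_on_compact.

(** * The oscillation pseudometric on each factor *)

Section oscillation.
Variables (R : realType) (n : nat) (X : 'I_n -> topologicalType).
Local Notation XX := (prod_topology X).
Hypothesis Xcompact : forall i, compact [set: X i].
Variables (f : XX -> R) (fcont : continuous f) (x0 : XX).

Let upd (z : XX) i (t : X i) : XX := dfwith z i t.

Lemma prod_compact : compact [set: XX].
Proof.
have := @tychonoff _ X (fun=> setT) Xcompact.
by congr compact; apply/seteqP; split.
Qed.

Definition oscillation i (s t : X i) : R :=
  sup (range (fun z : XX => `|f (upd z s) - f (upd z t)|)).

Lemma oscillation_ge i (s t : X i) z :
  `|f (upd z s) - f (upd z t)| <= oscillation s t.
Proof.
have [B hB] := continuous_compact_norm_bounded prod_compact fcont.
apply: ub_le_sup; last by exists z.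
exists (B + B) => _ [y _ <-].
by rewrite (le_trans (ler_normB _ _)) // lerD.
Qed.

Lemma oscillation_le i (s t : X i) e :
  (forall z, `|f (upd z s) - f (upd z t)| <= e) -> oscillation s t <= e.
Proof.
move=> le_e; apply: ge_sup; first by exists `|f (upd x0 s) - f (upd x0 t)|, x0.
by move=> _ [z _ <-].
Qed.

Lemma oscillation_sym i (s t : X i) : oscillation s t = oscillation t s.
Proof.
rewrite /oscillation; congr (sup (image _ _)).
by apply/funext => z; rewrite distrC.
Qed.

Lemma oscillation_xx i (t : X i) : oscillation t t = 0.
Proof.
apply/eqP; rewrite eq_le; apply/andP; split.
  by apply: oscillation_le => z; rewrite subrr normr0.
exact: le_trans (normr_ge0 _) (oscillation_ge t t x0).
Qed.

Lemma oscillation_triangle i (s t u : X i) :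
  oscillation s u <= oscillation s t + oscillation t u.
Proof.
apply: oscillation_le => z; rewrite -(subrKA (f (upd z t)) (f (upd z s))).
by apply: le_trans (ler_normD _ _) _; apply: lerD; exact: oscillation_ge.
Qed.

(* The tube lemma: the compact factor makes the estimate uniform in z. *)
Lemma near_oscillation i (t : X i) e : 0 < e ->
  \forall s \near t, oscillation t s <= e.
Proof.
move=> e_gt0.
suff h : \forall s \near t,
    [set: XX] `<=` (fun z => `|f (upd z t) - f (upd z s)| <= e).
  by apply: filterS h => s sP; apply: oscillation_le => z; exact: sP.
have /compact_near_coveringP := prod_compact; apply=> z _.
(* With the base point varying near [z] and [s] near [t], both values of [f] tend to [f (upd z t)],
   so their difference tends to 0. *)
have fc : f (upd p.1 p.2) @[p --> filter_prod (nbhs z) (nbhs t)] -->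
    f (upd z t).
  exact: cvg_comp _ _ (@dfwith_continuous2 _ X i z t) (@fcont _).
have fz : f (upd p.1 t) @[p --> filter_prod (nbhs z) (nbhs t)] --> f (upd z t).
  have h : (p.1, t) @[p --> filter_prod (nbhs z) (nbhs t)] -->
      filter_prod (nbhs z) (nbhs t).
    move=> A [[U V] /= [zU tV] UVA].
    exists (U, setT) => /=; first by split => //; exact: filterT.
    by move=> p [/= Up _]; apply: UVA; split => //=; exact: nbhs_singleton.
  exact: (cvg_comp _ _ h fc).
have /(_ (filter_prod_filter _ _))/cvgrPdist_le/(_ _ e_gt0) h := cvgB fz fc.
by apply: filterS h => p /=; rewrite subrr sub0r normrN.
Qed.

(** By the triangle inequality, moving from [t] to [s] changes [oscillation a] by at most
    [oscillation t s], which is small near [t]. *)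
Lemma oscillation_continuous i (a : X i) : continuous (oscillation a).
Proof.
move=> t; apply/cvgrPdist_le => e e_gt0.
apply: filterS (near_oscillation t e_gt0) => s ts.
have := oscillation_triangle a s t; have := oscillation_triangle a t s.
rewrite [oscillation s t]oscillation_sym ler_norml => *; lra.
Qed.

Lemma oscillation_net i e : 0 < e ->
  exists D : {fset X i}, forall t, exists2 a, a \in D & oscillation a t < e.
Proof.
move=> e_gt0.
(* compact_cover is only available for pointed spaces. *)
have : @compact (pointed_at (x0 i)) [set: X i] by exact: Xcompact.
rewrite compact_cover.
move=> /(_ (X i) setT (fun a => [set t | oscillation a t < e])).
case=> [a _|t _|D _ cD].
- have -> : [set t | oscillation a t < e] =
    oscillation a @^-1` [set r | r < e] by [].
  by apply: open_comp => // t _; exact: oscillation_continuous.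
- by exists t => //=; rewrite oscillation_xx.
- by exists D => t; have [a /= aD] := cD t I; exists a.
Qed.

(** Change [x] into [a] one coordinate at a time and telescope; [hyb k] has already taken its
    coordinates of index below [k] from [a]. *)
Lemma dist_le_sum_oscillation (x a : XX) :
  `|f x - f a| <= \sum_(i < n) oscillation (x i) (a i).
Proof.
pose hyb k : XX := fun i => if (i < k)%N then a i else x i.
have hyb0 : hyb 0 = x by apply/functional_extensionality_dep => i.
have hybn : hyb n = a.
  by apply/functional_extensionality_dep => i; rewrite /hyb ltn_ord.
have step (i : 'I_n) : `|f (hyb i) - f (hyb i.+1)| <= oscillation (x i) (a i).
  have := oscillation_ge (x i) (a i) (hyb i); congr (`|f _ - f _| <= _).
    apply/functional_extensionality_dep => j; rewrite /upd.
    by case: dfwithP => //; rewrite /hyb ltnn.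
  apply/functional_extensionality_dep => j; rewrite /upd.
  case: dfwithP => [|{}j ij]; first by rewrite /hyb ltnSn.
  rewrite /hyb ltnS [(j <= i)%N]leq_eqVlt (inj_eq (@ord_inj n)).
  by rewrite [j == i]eq_sym (negPf ij).
have := telescope_sumr (f \o hyb) (leq0n n); rewrite /= hyb0 hybn big_mkord.
rewrite distrC => <-; apply: le_trans (ler_norm_sum _ _ _) _.
by apply: ler_sum => i _; rewrite distrC.
Qed.

End oscillation.

(** * Weighted averages and extension from a finite grid *)

(** The weighted deviations from the mean sum to zero, so they cannot be positive at every point of
    positive weight. Positivity of the weight is kept since it will mean closeness to the averaged
    point. *)
Lemma weighted_average_ge (R : realFieldType) (T : eqType) (s : seq T)
    (w g : T -> R) :
    (forall a, 0 <= w a) -> 0 < \sum_(a <- s) w a ->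
  exists2 a, a \in s &
    0 < w a /\ g a <= (\sum_(a <- s) w a * g a) / \sum_(a <- s) w a.
Proof.
move=> w_ge0; set W := \sum_(a <- s) w a; set G := _ / W => W_gt0.
have sum0 : \sum_(a <- s) w a * (g a - G) = 0.
  under eq_bigr do rewrite mulrBr.
  by rewrite sumrB -mulr_suml -/W [W * G]mulrC divfK ?subrr // gt_eqF.
apply: contrapT => gG.
have {}gG a : a \in s -> 0 < w a -> G < g a.
  by move=> sa wa; rewrite ltNge; apply/negP => gaG; apply: gG; exists a.
have term_ge0 a : a \in s -> 0 <= w a * (g a - G).
  move=> sa; have := w_ge0 a; rewrite le_eqVlt => /predU1P[<-|wa].
    by rewrite mul0r.
  by rewrite mulr_ge0 ?w_ge0 // subr_ge0 ltW // gG.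
have /eqP := sum0; rewrite big_seq psumr_eq0 // => /allP term0.
suff : W = 0 by move=> W0; rewrite W0 ltxx in W_gt0.
rewrite /W big_seq big1 // => a sa.
have := w_ge0 a; rewrite le_eqVlt => /predU1P[<- //|wa].
have := term0 a sa; rewrite sa /= mulf_eq0 gt_eqF //= subr_eq0 => /eqP gaG.
by have := gG a sa wa; rewrite gaG ltxx.
Qed.

Lemma weighted_average_le (R : realFieldType) (T : eqType) (s : seq T)
    (w g : T -> R) :
    (forall a, 0 <= w a) -> 0 < \sum_(a <- s) w a ->
  exists2 a, a \in s &
    0 < w a /\ (\sum_(a <- s) w a * g a) / \sum_(a <- s) w a <= g a.
Proof.
move=> w_ge0 W_gt0.
have [a sa [wa]] := weighted_average_ge (fun a => - g a) w_ge0 W_gt0.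
under eq_bigr do rewrite mulrN.
by rewrite sumrN mulNr lerN2 => ga; exists a.
Qed.

Section approximation.
Variables (R : realType) (n : nat) (X : 'I_n -> topologicalType).
Local Notation XX := (prod_topology X).
Hypothesis Xcompact : forall i, compact [set: X i].
Variables (f : XX -> R) (fcont : continuous f).

Lemma univariate_sum_continuous (g : XX -> R) :
  univariate_sums g -> continuous g.
Proof.
move=> [G [Gc ->]]; apply: continuous_big => [|i _].
  exact: add_continuous.
move=> x; apply: (@continuous_comp _ _ _ (fun x : XX => x i) (G i)).
  exact: (@proj_continuous _ X i x).
exact: Gc.
Qed.

Lemma error_continuous (g : XX -> R) :
  univariate_sums g -> continuous (f \- g).
Proof.
move=> /univariate_sum_continuous gc x.
by apply: continuousB; [exact: fcont|exact: gc].
Qed.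

Lemma uniform_univariate_approximation (s e : R) : 0 <= s -> 0 < e ->
    (forall l lam, minimal_projection_cycle R l ->
       normalized_cycle_vector l lam -> `|\sum_(x <- l) lam x * f x| <= s) ->
  exists2 g : XX -> R, univariate_sums g &
    forall x, `|f x - g x| <= s + n%:R * e.
Proof.
move=> s_ge0 e_gt0 min_le.
have [[x0 _]|X0] := pselect (exists x0 : XX, True); last first.
  exists (fun=> 0); last by move=> x; case: X0; exists x.
  exists (fun _ _ => 0); split=> [i t|]; first exact: cvg_cst.
  by apply/funext => x; rewrite big1.
pose osc := oscillation f.
have [D netD] :=
  all_sig (fun i => cid (oscillation_net Xcompact fcont x0 i e_gt0)).
pose grid_point (k : {dffun forall i, D i}) : XX := fun i => fsval (k i).
pose P : {fset XX} := [fset grid_point k | k in {: {dffun forall i, D i}}]%fset.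
have inP (a : XX) : (forall i, a i \in D i) -> a \in P.
  move=> aD; apply/imfsetP; exists [ffun i => [` aD i]%fset] => //.
  by apply/functional_extensionality_dep => i; rewrite /grid_point ffunE.
have [g gP] := finite_approximation P s_ge0 min_le.
(* Continuous in [t], and positive exactly when [a] is at distance less than [e] from [t]; the net
   property makes the total weight positive. *)
pose w i (t a : X i) := Num.max (e - osc i a t) 0.
have w_ge0 i (t a : X i) : 0 <= w i t a by rewrite le_max lexx orbT.
have W_gt0 i (t : X i) : 0 < \sum_(a <- D i) w i t a.
  have [a aD at_e] := netD i t.
  rewrite (big_fsetD1 a) //= ltr_pwDl ?sumr_ge0 //.
  by rewrite lt_max subr_gt0 at_e.
have w_osc i (t a : X i) : 0 < w i t a -> osc i t a <= e.
  rewrite lt_max ltxx orbF subr_gt0 => /ltW.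
  by rewrite /osc oscillation_sym.
have w_cont i (a : X i) : continuous (fun t => w i t a).
  move=> t; apply: (@continuous_max _ _ (fun t => e - osc i a t) (fun=> 0)).
    apply: continuousB; first exact: cvg_cst.
    exact: oscillation_continuous.
  exact: cvg_cst.
pose G i (t : X i) :=
  (\sum_(a <- D i) w i t a * g i a) / \sum_(a <- D i) w i t a.
(* The error is at most [s] at the grid point [a], and replacing [a] by [x] in [f] costs at most [e]
   per coordinate. *)
have near_grid (x a : XX) : (forall i, a i \in D i) ->
    (forall i, 0 < w i (x i) (a i)) ->
    `|f x - \sum_(i < n) g i (a i)| <= s + n%:R * e.
  move=> aD aw; rewrite -(subrKA (f a)) addrC.
  apply: le_trans (ler_normD _ _) _; apply: lerD; first exact/gP/inP.
  apply: le_trans (dist_le_sum_oscillation Xcompact fcont x a) _.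
  rewrite mulr_natl -[X in _ *+ X]card_ord -sumr_const.
  by apply: ler_sum => i _; exact: w_osc.
exists (fun x => \sum_(i < n) G i (x i)).
  exists G; split=> // i t; apply: cvgM.
    apply: cvg_big => [|a _]; first exact: add_continuous.
    by apply: cvgM; [exact: w_cont|exact: cvg_cst].
  apply: cvgV; first by rewrite gt_eqF.
  by apply: cvg_big => [|a _]; [exact: add_continuous|exact: w_cont].
move=> x; rewrite ler_norml; apply/andP; split.
  (* In each coordinate separately, take a net point where [g i] is at least its average: [f x]
     minus the sum of the averages is then bounded below by an error controlled by [near_grid]. The
     upper bound is symmetric. *)
  have := fun i =>
    cid2 (weighted_average_le (g i) (w_ge0 i (x i)) (W_gt0 i (x i))).
  move=> /all_sig2[a] aD aw; have := near_grid x a aD (fun i => (aw i).1).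
  rewrite ler_norml => /andP[h _]; apply: le_trans h _.
  by rewrite lerB //; apply: ler_sum => i _; exact: (aw i).2.
have := fun i =>
  cid2 (weighted_average_ge (g i) (w_ge0 i (x i)) (W_gt0 i (x i))).
move=> /all_sig2[a] aD aw; have := near_grid x a aD (fun i => (aw i).1).
rewrite ler_norml => /andP[_ h]; apply: le_trans h.
by rewrite lerB //; apply: ler_sum => i _; exact: (aw i).2.
Qed.

End approximation.

(** * Integrals over cycles and weak duality *)

(** For a set that is empty or unbounded above, [sup] takes the default value 0. *)
Lemma sup_nonneg (R : realType) (A : set R) :
  (forall x, A x -> 0 <= x) -> 0 <= sup A.
Proof.
move=> A_ge0; have [supA|/sup_out->//] := pselect (has_sup A).
by have [[x Ax] ubA] := supA; rewrite (le_trans (A_ge0 x Ax)) // ub_le_sup.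
Qed.

Section cycle_integrals.
Variables (R : realType) (n : nat) (X : 'I_n -> topologicalType).
Local Notation XX := (prod_topology X).
Hypothesis Xcompact : forall i, compact [set: X i].
Hypothesis Xhausdorff : forall i, hausdorff_space (X i).
Variables (f : XX -> R) (fcont : continuous f).

Lemma borel_measurable_set1 (x0 x : XX) : measurable ([set x] : set (borel x0)).
Proof.
have XXh : hausdorff_space XX := hausdorff_product Xhausdorff.
have /accessible_closed_set1/(_ x)/closed_openC := hausdorff_accessible XXh.
move=> oC; rewrite -[X in measurable X]setCK; apply: measurableC.
exact: sub_sigma_algebra.
Qed.

Lemma continuous_borel_measurable (x0 : XX) :
  measurable_fun setT (f : borel x0 -> R).
Proof.
apply: (measurability _ (RGenOpens.measurableE R)).
move=> _ [_ [a [b ->]] <-]; rewrite setTI; apply: sub_sigma_algebra.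
by apply: open_comp => // x _; exact: fcont.
Qed.

Lemma cycle_integralE (l : {fset XX}) (lam : XX -> R) (x0 : XX) :
  charge_integral (cycle_measure l lam x0) f = \sum_(x <- l) lam x * f x.
Proof.
apply: charge_integral_point_masses; last exact: continuous_borel_measurable.
  exact: borel_measurable_set1.
exact: fset_uniq.
Qed.

(** A cycle measure annihilates sums of univariate functions, so [f] may be replaced by [f \- g],
    and its total variation is 1. *)
Lemma cycle_integrals_le_uniform_norm (g : XX -> R) r :
  univariate_sums g -> cycle_integrals f r -> r <= uniform_norm (f \- g).
Proof.
move=> gM [l [lam [x0 [_ [cl lam1] ->]]]]; rewrite cycle_integralE.
have [G [_ gE]] := gM.
have -> : \sum_(x <- l) lam x * f x = \sum_(x <- l) lam x * (f \- g) x.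
  under [RHS]eq_bigr do rewrite /= mulrBr.
  by rewrite sumrB gE (cycle_vector_integral_sums G cl) subr0.
apply: le_trans (ler_norm_sum _ _ _) _.
rewrite -[leRHS]mul1r -lam1 mulr_suml; apply: ler_sum => x _.
rewrite normrM ler_wpM2l //.
by apply: (uniform_norm_ge (prod_compact Xcompact)); exact: error_continuous.
Qed.

End cycle_integrals.

Theorem theorem3p10 (R : realType) (n : nat) (X : 'I_n -> topologicalType)
  (hn : (0 < n)%N)
  (Xcompact : forall i, compact [set: X i])
  (Xhausdorff : forall i, hausdorff_space (X i))
  (f : prod_topology X -> R) (fcont : continuous f) :
  approx_error f = sup (cycle_integrals f).
Proof.
have le_norm := cycle_integrals_le_uniform_norm Xcompact Xhausdorff fcont.
have M0 : univariate_sums (fun _ : prod_topology X => 0 : R).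
  exists (fun _ _ => 0); split=> [i t|]; first exact: cvg_cst.
  by apply/funext => x; rewrite big1.
have norm_ge0 (h : prod_topology X -> R) : 0 <= uniform_norm h.
  by apply: sup_nonneg => _ [x _ <-].
have ubC : has_ubound (cycle_integrals f).
  by exists (uniform_norm (f \- fun=> 0)) => r; exact: le_norm.
have sup_ge_0 : 0 <= sup (cycle_integrals f).
  by apply: sup_nonneg => _ [l [lam [x0 [_ _ ->]]]].
apply/eqP; rewrite eq_le; apply/andP; split; last first.
  apply: lb_le_inf.
    by exists (uniform_norm (f \- fun=> 0)); exists (fun=> 0).
  move=> _ [g gM <-].
  (* Without minimal cycles the supremum is 0, and the norm is nonnegative. *)
  have [->|/set0P C0] := eqVneq (cycle_integrals f) set0; first by rewrite sup0.
  by apply: ge_sup => // r; exact: le_norm.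
have min_le l lam : minimal_projection_cycle R l ->
    normalized_cycle_vector l lam ->
    `|\sum_(x <- l) lam x * f x| <= sup (cycle_integrals f).
  (* A cycle is nonempty, so one of its points can be the designated point of the Borel space. *)
  move=> lmin nlam; have [[/fset0Pn[x0 _] _] _] := lmin.
  apply: ub_le_sup => //; exists l, lam, x0; split=> //.
  by rewrite cycle_integralE.
apply/ler_addgt0Pr => e e_gt0.
(* Each of the [n] coordinates contributes one net radius to the error, hence the division by
   [n]. *)
have en_gt0 : 0 < e / n%:R by rewrite divr_gt0 // ltr0n.
have [g gM g_le] :=
  uniform_univariate_approximation Xcompact fcont sup_ge_0 en_gt0 min_le.
apply: (@le_trans _ _ (uniform_norm (f \- g))).
  by apply: ge_inf; [exists 0 => _ [h _ <-]|exists g].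
rewrite [n%:R * _]mulrC divfK ?pnatr_eq0 -?lt0n // in g_le.
(* On an empty product the norm is [sup set0], which is 0. *)
have [[x0 _]|X0] := pselect (exists x0 : prod_topology X, True).
  by apply: ge_sup => [|_ [x _ <-]]; [exists `|(f \- g) x0|, x0|exact: g_le].
rewrite /uniform_norm [X in sup X](_ : _ = set0) ?sup0 ?addr_ge0 // ?ltW //.
by rewrite -subset0 => y [x _ _]; case: X0; exists x.
Qed.
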